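(* Let $\Gamma$ be a finite tape alphabet with $|\Gamma|\ge2$ containing a blank symbol $\Box$, and let $\sigma_\Box:\mathbb Z\to\Gamma$ be the constant function with value $\Box$. For every tape automaton $m$ over input alphabet $A_\tau=A\cup\{\tau\}$ and tape alphabet $\Gamma$, and every state $x$, the language $\{w\in A^*\mid \llbracket x\rrbracket^\tau_m(w)(0,\sigma_\Box)=1\}$ is recursively enumerable. Conversely, every recursively enumerable language $\mathcal L\subseteq A^*$ is of this form for some such tape automaton $m$ and state $x$.
   Context: Notation: $\sigma=_{i\pm k}\sigma'$ iff $\sigma(j)=\sigma'(j)$ for all $|i-j|\le k$; $\sigma=^{i\pm k}\sigma'$ iff $\sigma(j)=\sigma'(j)$ for all $|i-j|>k$; $\sigma_{+j}=\sigma\circ(\lambda i.i+j)$. Tape monad: $TX$ is the set of $\langle r,z,t\rangle:\mathbb Z\times\Gamma^{\mathbb Z}\to X\times\mathbb Z\times\Gamma^{\mathbb Z}$ for which there is $k\ge0$ such that for all $i,j\in\mathbb Z$ and $\sigma=_{i\pm k}\sigma'$: $t(i,\sigma)=_{i\pm k}t(i,\sigma')$, $r(i,\sigma)=r(i,\sigma')$, $|z(i,\sigma)-i|\le k$, $t(i,\sigma)=^{i\pm k}\sigma$, $z(i,\sigma)=z(i,\sigma')$, $t(i,\sigma_{+j})=t(i+j,\sigma)_{+j}$, $r(i,\sigma_{+j})=r(i+j,\sigma)$, $z(i,\sigma_{+j})=z(i+j,\sigma)-j$; unit $\eta(x)(i,\sigma)=(x,i,\sigma)$, Kleisli $f^\dagger(\langle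 r,z,t\rangle)(i,\sigma)=f(r(i,\sigma))(z(i,\sigma),t(i,\sigma))$. A tape automaton over $A_\tau$ is a finite set $X$ with maps $o^m:X\to B$, $t^m:A_\tau\times X\to TX$, where $B$ is the set of $p\in2^{\mathbb Z\times\Gamma^{\mathbb Z}}$ for which there is $k$ with $p(i,\sigma)=p(i,\sigma')$ whenever $\sigma=_{i\pm k}\sigma'$ and $p(i,\sigma_{+j})=p(i+j,\sigma)$, with $\mathbb T$-algebra $a^m(\langle r,z,t\rangle)(i,\sigma)=r(i,\sigma)(z(i,\sigma),t(i,\sigma))$; $B$ is an $\omega$-additive monoid under pointwise (countable) disjunction. Observational semantics: let $T_BX=B^{(B^X)}$ be the continuation monad, $\kappa_X(p)=\lambda f.a^m(Tf(p))$, $t^{m_*}=\kappa_X\circ t^m$, $o^{m_*}=o^m$; $T_BX$ is $\omega$-additive pointwise. Define the $\mathbb T_B$-automaton $m_v$ over $A$ with $a^{m_v}(k)=k(\mathrm{id})$, $t^{m_v}(x_0,a)=\sum_{i\ge1}\mathsf{do}\ x_1\leftarrow t^{m_*}(x_0,\tau);\dots;x_{i-1}\leftarrow t^{m_*}(x_{i-2},\tau);\ t^{m_*}(x_{i-1},a)$ and $o^{m_v}(x_0)=o^{m_*}(x_0)+\sum_{i\ge1}\big(\mathsf{do}\ x_1\leftarrow t^{m_*}(x_0,\tau);\dots;\ t^{m_*}(x_{i-1},\tau)\big)(o^{m_*})$, where $\mathsf{do}\ y\leftarrow q;\ g(y)$ means $g^\dagger(q)$ in $\mathbb T_B$. Then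 $\llbracket x\rrbracket^\tau_m=\llbracket x\rrbracket_{m_v}$, the trace semantics of $m_v$: $\llbracket x\rrbracket_{m_v}(\epsilon)=o^{m_v}(x)$, $\llbracket x\rrbracket_{m_v}(au)=a^{m_v}\big(\mathsf{do}\ y\leftarrow t^{m_v}(x,a);\ \eta(\llbracket y\rrbracket_{m_v}(u))\big)$.
   Formalization: The context's B is not closed under countable disjunction (the uniform bound k may fail), so the sums defining the semantics are evaluated pointwise among all predicates on positions and tapes instead of in B; the output maps of the automaton still take values in B. *)

(* Defs.v *)
From Stdlib Require Import ZArith.
From mathcomp Require Import all_boot.

Set Implicit Arguments.
Unset Strict Implicit.
Unset Printing Implicit Defensive.

Definition Tape (G : Type) := Z -> G.

Definition near (G : Type) (i : Z) (k : nat) (s s' : Tape G) : Prop :=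
  forall j : Z, (Z.abs (i - j) <= Z.of_nat k)%Z -> s j = s' j.

Definition far (G : Type) (i : Z) (k : nat) (s s' : Tape G) : Prop :=
  forall j : Z, (Z.abs (i - j) > Z.of_nat k)%Z -> s j = s' j.

Definition shiftT (G : Type) (s : Tape G) (j : Z) : Tape G := fun i => s (i + j)%Z.

(* The tape monad T: a triple <r,z,t> packed as one function.          *)

Definition is_tape_op (G X : Type) (p : Z -> Tape G -> X * Z * Tape G) : Prop :=
  let r := fun i s => (p i s).1.1 in
  let z := fun i s => (p i s).1.2 in
  let t := fun i s => (p i s).2 in
  exists k : nat, forall (i j : Z) (s s' : Tape G), near i k s s' ->
    near i k (t i s) (t i s') /\
    r i s = r i s' /\
    (Z.abs (z i s - i) <= Z.of_nat k)%Z /\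
    far i k (t i s) s /\
    z i s = z i s' /\
    (forall l, t i (shiftT s j) l = shiftT (t (i + j)%Z s) j l) /\
    r i (shiftT s j) = r (i + j)%Z s /\
    z i (shiftT s j) = (z (i + j)%Z s - j)%Z.

Definition TX (G X : Type) := {p : Z -> Tape G -> X * Z * Tape G | is_tape_op p}.

Definition is_obs (G : Type) (p : Z -> Tape G -> bool) : Prop :=
  exists k : nat, forall (i j : Z) (s s' : Tape G), near i k s s' ->
    p i s = p i s' /\ p i (shiftT s j) = p (i + j)%Z s.

Definition B (G : Type) := {p : Z -> Tape G -> bool | is_obs p}.

(* Tape automata over A_tau = A + {tau}; tau is modelled by None.      *)

Record TapeAut (A G : finType) := {
  state : finType;
  out : state -> B G;
  trans : option A -> state -> TX G state
}.

(* Observational semantics.  Observations are used as raw predicates   *)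
(* (countable disjunction = existential).                *)

Definition Bp (G : Type) := Z -> Tape G -> Prop.

Definition B2Bp (G : Type) (b : B G) : Bp G := fun i s => is_true (sval b i s).

Definition TB (G X : Type) := (X -> Bp G) -> Bp G.
Definition etaB (G X : Type) (x : X) : TB G X := fun f => f x.
Definition bindB (G X Y : Type) (g : X -> TB G Y) (q : TB G X) : TB G Y :=
  fun f => q (fun y => g y f).
Definition sumB (G X : Type) (k : nat -> TB G X) : TB G X :=
  fun f i s => exists n, k n f i s.

(* kappa_X(p) = fun f => a^m (T f p),  a^m(<r,z,t>)(i,s) = r(i,s)(z(i,s),t(i,s)) *)
Definition kappa (G X : Type) (p : TX G X) : TB G X :=
  fun f i s => f (sval p i s).1.1 (sval p i s).1.2 (sval p i s).2.

Section Sem.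
Variables (A G : finType) (m : TapeAut A G).

Definition tstar (x : state m) (a : option A) : TB G (state m) := kappa (@trans A G m a x).

Fixpoint taus (Y : Type) (n : nat) (fin : state m -> TB G Y) (x0 : state m) : TB G Y :=
  match n with
  | 0 => fin x0
  | n'.+1 => bindB (fun x1 => taus n' fin x1) (tstar x0 None)
  end.

Definition tv (x0 : state m) (a : A) : TB G (state m) :=
  sumB (fun n => taus n (fun y => tstar y (Some a)) x0).

Definition ov (x0 : state m) : Bp G :=
  fun i s => B2Bp (@out A G m x0) i s \/
    exists n, taus n (fun y => tstar y None) x0 (fun x => B2Bp (@out A G m x)) i s.

Definition av (k : TB G (Bp G)) : Bp G := k id.

Fixpoint tau_sem (w : seq A) : state m -> Bp G :=
  match w with
  | [::] => fun x => ov x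
  | a :: u => fun x => av (bindB (fun y => @etaB G (Bp G) (tau_sem u y)) (tv x a))
  end.

End Sem.

Definition tau_lang (A G : finType) (blank : G) (m : TapeAut A G) (x : state m)
  : seq A -> Prop :=
  fun w => @tau_sem A G m w x 0%Z (fun _ => blank).

Record TM (A : finType) := {
  tmQ : finType;
  tmS : finType;
  tm_in : A -> tmS;
  tm_blank : tmS;
  tm_start : tmQ;
  tm_delta : tmQ -> tmS -> option (tmQ * tmS * bool)  (* None = halt; true = move right *)
}.

Definition tm_config (A : finType) (M : TM A) := (tmQ M * Tape (tmS M) * Z)%type.

Definition tm_step (A : finType) (M : TM A) (c : tm_config M) : option (tm_config M) :=
  let: (q, tp, h) := c in
  match tm_delta q (tp h) with
  | None => None
  | Some (q', a, d) =>
      Some (q', (fun j => if (j =? h)%Z then a else tp j),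
            (if d then h + 1 else h - 1)%Z)
  end.

Fixpoint tm_run (A : finType) (M : TM A) (n : nat) (c : tm_config M) : option (tm_config M) :=
  match n with
  | 0 => Some c
  | n'.+1 => obind (@tm_step A M) (@tm_run A M n' c)
  end.

Definition tm_init (A : finType) (M : TM A) (w : seq A) : tm_config M :=
  (tm_start M,
   (fun j => if (j <? 0)%Z then tm_blank M
             else nth (tm_blank M) (map (@tm_in A M) w) (Z.to_nat j)),
   0%Z).

Definition tm_halts (A : finType) (M : TM A) (w : seq A) : Prop :=
  exists n, @tm_run A M n (@tm_init A M w) = None.

Definition re_lang (A : finType) (L : seq A -> Prop) : Prop :=
  exists M : TM A, forall w, L w <-> tm_halts M w.

Arguments tau_lang {A G} blank m x w.
Arguments re_lang {A} L.

(* Main.v *)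
Require Import Defs.
From Stdlib Require Import ZArith Lia FunctionalExtensionality.
From HB Require Import structures.
From mathcomp Require Import all_boot zify.

(** By equivariance a configuration of a tape automaton is a state and a tape seen
from the head, and a word is accepted iff some schedule, i.e. a list of booleans
saying when to read the next letter and when to take a silent step, ends with the
input consumed in an accepting configuration.

A deterministic machine with six stacks enumerates all schedules (as numbers in
bijective binary notation) and halts at the first accepting one; it keeps a window
around the head in its finite control, large enough for one step of the automaton,
and the rest of the tape on two stacks.  Any multi-stack machine is simulated by a
Turing machine whose cell number j holds the j-th entry of every stack.

Conversely a tape automaton codes the symbols of a Turing machine by blocks of
cells.  It writes the input while reading letters, marking the blocks it has used;
the first silent step makes it return to the leftmost block and run the machine, one
step per silent step, and reading a further letter leads to a dead state. *)

Set Implicit Arguments.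
Unset Strict Implicit.
Unset Printing Implicit Defensive.

(** * Deterministic partial systems and simulations *)

Section PartialSystems.
Variables (T : Type) (f : T -> option T).

Definition orun n c := iter n (obind f) (Some c).
Definition halts c := exists n, orun n c = None.
Definition reach c c' := exists n, orun n c = Some c'.
Definition reach1 c c' := exists n, orun n.+1 c = Some c'.

Lemma orunS n c c' : f c = Some c' -> orun n.+1 c = orun n c'.
Proof. by move=> fc; rewrite /orun iterSr /= fc. Qed.

Lemma orun_none n : iter n (obind f) None = None.
Proof. by elim: n => //= n ->. Qed.

Lemma orun_reach n p c c' : orun n c = Some c' -> orun (p + n) c = orun p c'.
Proof. by rewrite /orun iterD => ->. Qed.

Lemma reach_refl c : reach c c.
Proof. by exists 0. Qed.

Lemma reach_trans c1 c2 c3 : reach c1 c2 -> reach c2 c3 -> reach c1 c3.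
Proof. by move=> [n h1] [p h2]; exists (p + n); rewrite (orun_reach _ h1). Qed.

Lemma reach1W c c' : reach1 c c' -> reach c c'.
Proof. by case=> n h; exists n.+1. Qed.

Lemma reach1_step c c' : f c = Some c' -> reach1 c c'.
Proof. by move=> h; exists 0; rewrite (orunS _ h). Qed.

Lemma reach1_trans c1 c2 c3 : reach1 c1 c2 -> reach c2 c3 -> reach1 c1 c3.
Proof.
move=> [n h1] [p h2]; exists (p + n).
by rewrite -addnS (orun_reach _ h1).
Qed.

Lemma reach_step c c' c'' : f c = Some c' -> reach c' c'' -> reach1 c c''.
Proof. by move=> /reach1_step h /(reach1_trans h). Qed.

Lemma halts_reach c c' : reach c c' -> halts c <-> halts c'.
Proof.
case=> n h; split=> -[p hp]; last by exists (p + n); rewrite (orun_reach _ h).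
by exists p; rewrite -(orun_reach p h) addnC /orun iterD [iter p _ _]hp orun_none.
Qed.

(** By determinism, a run that dies within [p] steps first passes through [c']. Since at least one
    step leads there, fewer than [p] remain, which drives the strong induction below. *)
Lemma orun_pred n p c c' : orun n.+1 c = Some c' -> orun p c = None ->
  exists2 r, r < p & orun r c' = None.
Proof.
move=> h hp; case: (ltnP n p) => np; last first.
  by move: h; rewrite -(subnK (leqW np)) /orun iterD [iter p _ _]hp orun_none.
exists (p - n.+1); first by rewrite ltn_subrL (leq_ltn_trans _ np).
by rewrite -(orun_reach _ h) subnK.
Qed.

End PartialSystems.

(** Halting of [g] transfers to [f] by induction on the steps of [g]. For the converse, [reach1]
    charges at least one step of [f] to each step of [g], so the remaining run of [f] shrinks. *)
Lemma halts_simulation (T U : Type) (f : T -> option T) (g : U -> option U)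
    (R : U -> T -> Prop) :
  (forall u t, R u t ->
     if g u is Some u' then exists2 t', reach1 f t t' & R u' t' else halts f t) ->
  forall u t, R u t -> halts g u <-> halts f t.
Proof.
move=> sim u t Rut; split=> -[n].
  elim: n u t Rut => [//|n IH] u t /sim; rewrite /orun iterSr /=.
  case: (g u) => [u'|] //= [t' tt' Rt'] h.
  by apply/(halts_reach (reach1W tt')); apply: IH Rt' h.
elim/ltn_ind: n u t Rut => n IH u t /sim.
case gu: (g u) => [u'|]; last by exists 1; rewrite /orun /= gu.
move=> [t' [p tt'] Rt'] ht.
have [r rn /(IH _ rn _ _ Rt') [q hq]] := orun_pred tt' ht.
by exists q.+1; rewrite (orunS _ gu).
Qed.

(** * Tape automata in coordinates relative to the head *)

Lemma shiftT0 (G : Type) (s : Tape G) : shiftT s 0%Z = s.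
Proof. by apply: functional_extensionality => j; rewrite /shiftT Z.add_0_r. Qed.

Lemma shiftTD (G : Type) (s : Tape G) i j :
  shiftT (shiftT s i) j = shiftT s (j + i)%Z.
Proof. by apply: functional_extensionality => l; rewrite /shiftT; congr s; lia. Qed.

Section Relative.
Variables (A G : finType) (m : TapeAut A G).

(** Moving the origin to the head after each step means that operations are evaluated at position 0
    only. *)
Definition rel_step (a : option A) (c : state m * Tape G) : state m * Tape G :=
  let p := sval (trans a c.1) 0%Z c.2 in (p.1.1, shiftT p.2 p.1.2).

Definition rel_out (c : state m * Tape G) : bool := sval (out c.1) 0%Z c.2.

Fixpoint rel_acc (w : seq A) (c : state m * Tape G) : Prop :=
  if w is a :: u then exists n, rel_acc u (rel_step (Some a) (iter n (rel_step None) c))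
  else exists n, rel_out (iter n (rel_step None) c).

Definition equivariant (f : state m -> Bp G) (P : state m * Tape G -> Prop) :=
  forall x i s, f x i s <-> P (x, shiftT s i).

(** By the shift laws, acting at [i] and recentring at the new head gives the same tape as
    recentring at [i], acting at 0 and recentring again. *)
Lemma tstar_equivariant a f P : equivariant f P ->
  equivariant (fun x => tstar x a f) (fun c => P (rel_step a c)).
Proof.
move=> fP x i s; rewrite /tstar /kappa fP /rel_step /=.
case: (trans a x) => p [k /= pk].
have [_ [_ [_ [_ [_ [ht [hr hz]]]]]]] := pk 0%Z i s s (fun _ _ => erefl).
rewrite hr hz Z.add_0_l; set l := shiftT _ _; set l' := shiftT _ _.
suff -> : l = l' by [].
apply: functional_extensionality => j; rewrite /l /l' {1 2}/shiftT ht /shiftT.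
by rewrite Z.add_0_l; congr (_.2 _); lia.
Qed.

Lemma taus_equivariant Y (fin : state m -> TB G Y) f n P :
  equivariant (fun x => fin x f) P ->
  equivariant (fun x => taus n fin x f) (fun c => P (iter n (rel_step None) c)).
Proof.
elim: n => [//|n IH] finP.
have h := tstar_equivariant None (IH finP).
by move=> x i s; rewrite iterSr; apply: h.
Qed.

Lemma out_equivariant : equivariant (fun x => B2Bp (out x)) rel_out.
Proof.
move=> x i s; rewrite /B2Bp /rel_out /=; case: (out x) => p [k /= pk].
by have [_ ->] := pk 0%Z i s s (fun _ _ => erefl).
Qed.

Lemma tau_sem_equivariant w : equivariant (@tau_sem A G m w) (rel_acc w).
Proof.
elim: w => [|a u IH] x i s /=; last first.
  have h n := taus_equivariant (fin := fun y => tstar y (Some a)) n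
    (tstar_equivariant (Some a) IH) x i s.
  by split=> -[n hn]; exists n; apply/h.
have h n := taus_equivariant (fin := fun y => tstar y None) n
  (tstar_equivariant None out_equivariant) x i s.
(* In [ov] the case without silent steps stands apart, and the summand of index [n] takes [n.+1] of
   them. *)
have h0 := out_equivariant x i s; rewrite /ov; split.
  by case=> [/h0 hx|[n /h hn]]; [exists 0 | exists n.+1].
by case=> -[|n] hn; [left; apply/h0 | right; exists n; apply/h].
Qed.

Lemma tau_langP blank x w :
  tau_lang blank m x w <-> rel_acc w (x, fun=> blank).
Proof.
rewrite /tau_lang tau_sem_equivariant.
suff -> : shiftT (fun=> blank) 0%Z = (fun=> blank : G) by [].
exact: shiftT0.
Qed.

End Relative.

(** * Multi-stack machines and their simulation by Turing machines *)

Inductive stack_cmd (S : Type) := Keep | Pop | Push of S.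
Arguments Keep {S}.
Arguments Pop {S}.

Definition exec_cmd (S : Type) (x : stack_cmd S) (s : seq S) : seq S :=
  match x with Keep => s | Pop => behead s | Push y => y :: s end.

Definition cmd_code (S : Type) (x : stack_cmd S) : option (option S) :=
  match x with Keep => None | Pop => Some None | Push y => Some (Some y) end.
Definition cmd_decode (S : Type) (x : option (option S)) : stack_cmd S :=
  match x with None => Keep | Some None => Pop | Some (Some y) => Push y end.
Lemma cmd_codeK S : cancel (@cmd_code S) (@cmd_decode S).
Proof. by case. Qed.

HB.instance Definition _ (S : finType) :=
  Countable.copy (stack_cmd S) (can_type (@cmd_codeK S)).
HB.instance Definition _ (S : finType) :=
  Finite.copy (stack_cmd S) (can_type (@cmd_codeK S)).

Section StackMachines.
Variables (A Q K S : finType).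
Variable delta : Q -> (K -> option S) -> option (Q * (K -> stack_cmd S)).

Definition stack_step (c : Q * (K -> seq S)) : option (Q * (K -> seq S)) :=
  if delta c.1 (fun k => ohead (c.2 k)) is Some (q, x)
  then Some (q, fun k => exec_cmd (x k) (c.2 k)) else None.

Variables (k0 : K) (in_sym : A -> S) (q0 : Q).

Definition stack_init (w : seq A) : Q * (K -> seq S) :=
  (q0, fun k => if k == k0 then map in_sym w else [::]).

(* Cell [j] of the Turing tape stores the [j]-th entry, counted from the top,
   of every stack; [None] marks the cells outside of the region in use.  A step
   of the stack machine is a sweep to the right which moves the stacks that are
   pushed, followed by a sweep to the left which moves the ones that are popped. *)
Definition cell := {ffun K -> option S}.
Definition cmds := {ffun K -> stack_cmd S}.

Definition no_entry : cell := [ffun=> None].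
Definition pushed (x : cmds) : cell := [ffun k => if x k is Push y then Some y else None].
Definition push_cell (x : cmds) (carry v : cell) : cell :=
  [ffun k => if x k is Push _ then carry k else v k].
Definition pop_cell (x : cmds) (carry v : cell) : cell :=
  [ffun k => if x k is Pop then carry k else v k].

Definition sweep_state := (Q + bool * Q * cmds * cell)%type.
Definition right_state q x carry : sweep_state := inr (true, q, x, carry).
Definition left_state q x carry : sweep_state := inr (false, q, x, carry).

(** The carry is the old content of the cell on the left. The sweep always claims one fresh cell at
    the end, so every push has room. *)
Definition right_sweep q (x : cmds) (carry : cell) (c : option cell)
    : sweep_state * option cell * bool :=
  let v := odflt no_entry c in
  let v' := push_cell x carry v in
  if c is Some _ then (right_state q x v, Some v', true)
  else (left_state q x v', Some v', false).

Definition left_sweep q (x : cmds) (carry : cell) (c : option cell)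
    : sweep_state * option cell * bool :=
  if c is Some v then (left_state q x v, Some (pop_cell x carry v), false)
  else (inl q, None, true).

Definition sweep_delta (st : sweep_state) (c : option cell)
    : option (sweep_state * option cell * bool) :=
  match st with
  | inl q =>
      if delta q (odflt no_entry c) is Some (q', x)
      then Some (right_sweep q' (finfun x) (pushed (finfun x)) c) else None
  | inr (d, q, x, carry) =>
      Some ((if d then right_sweep else left_sweep) q x carry c)
  end.

Definition sweep_TM : TM A :=
  {| tmQ := sweep_state; tmS := option cell;
     tm_in := fun a => Some [ffun k => if k == k0 then Some (in_sym a) else None];
     tm_blank := None; tm_start := inl q0; tm_delta := sweep_delta |}.

Definition entries (s : K -> seq S) (j : nat) : cell := [ffun k => onth (s k) j].

(* Cells below [p] describe the stacks [s], the other ones the stacks [s']. *)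
Definition mixed_tape (n p : nat) (s s' : K -> seq S) : Tape (option cell) :=
  fun j => if (j <? 0)%Z then None
           else if Z.to_nat j < n
           then Some (entries (if Z.to_nat j < p then s else s') (Z.to_nat j)) else None.

Definition stack_tape n s := mixed_tape n 0 s s.

Lemma mixed_tape_nat n p s s' j : mixed_tape n p s s' (Z.of_nat j) =
  if j < n then Some (entries (if j < p then s else s') j) else None.
Proof. by rewrite /mixed_tape Nat2Z.id; case: Z.ltb_spec => //; lia. Qed.

Local Notation TMstep := (@tm_step A sweep_TM).
Local Notation conf q t h := ((q : tmQ sweep_TM), (t : Tape (tmS sweep_TM)), h%Z).

Section OneStep.
Variables (q : Q) (x : K -> stack_cmd S) (s : K -> seq S) (n : nat).
Hypothesis size_s : forall k, size (s k) <= n.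

Let pushes (k : K) := if x k is Push y then y :: s k else s k.
Let final (k : K) := exec_cmd (x k) (s k).
Let carry p := if p is p'.+1 then entries s p' else pushed (finfun x).

Lemma push_cell_entries p : push_cell (finfun x) (carry p) (entries s p) = entries pushes p.
Proof.
apply/ffunP => k; rewrite /pushes !ffunE; case xk: (x k) => [||y] //.
by case: p => [|p] /=; rewrite !ffunE ?xk.
Qed.

Lemma pop_cell_entries p :
  pop_cell (finfun x) (entries pushes p.+1) (entries pushes p) = entries final p.
Proof.
apply/ffunP => k; rewrite /pushes /final !ffunE; case: (x k) => //=.
by case: (s k) => [|a l]; rewrite /= ?onth0n.
Qed.

Lemma entries_end : entries s n = no_entry.
Proof. by apply/ffunP => k; rewrite !ffunE onth_default. Qed.

(** A popped stack has no entry at depth [n] either before or after the pop, so the last cell is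
    already correct and the left sweep may start at [n - 1]. *)
Lemma entries_final_end : entries pushes n = entries final n.
Proof.
apply/ffunP => k; rewrite /pushes /final !ffunE; case: (x k) => //=.
by rewrite !onth_default // size_behead (leq_trans (leq_pred _)).
Qed.

Lemma right_sweep_reach p : p <= n ->
  reach1 TMstep
    (conf (right_state q (finfun x) (carry p)) (mixed_tape n p pushes s) (Z.of_nat p))
    (conf (left_state q (finfun x) (entries pushes n))
      (mixed_tape n.+1 n pushes final) (Z.of_nat n - 1)).
Proof.
move=> pn; have [d] : exists d, p + d = n by exists (n - p); rewrite subnKC.
elim: d p {pn} => [|d IH] p; rewrite ?addn0 ?addnS => hn.
  subst p; apply: reach1_step; rewrite /= mixed_tape_nat ltnn /=.
  have := push_cell_entries n; rewrite entries_end => ->.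
  congr (Some (_, _, _)); apply: functional_extensionality => j.
  rewrite /mixed_tape; case: Z.eqb_spec => [->|jn].
    rewrite Nat2Z.id ltnSn ltnn entries_final_end; case: Z.ltb_spec => //; lia.
  case: Z.ltb_spec => // j0; have -> : Z.to_nat j < n.+1 = (Z.to_nat j < n).
    by rewrite ltnS leq_eqVlt; case: eqP => //; lia.
  by case: ltnP.
apply: reach_step; last by apply/reach1W/(IH p.+1).
have pn : p < n by rewrite -hn ltnS leq_addr.
rewrite [LHS]/= mixed_tape_nat pn ltnn /= push_cell_entries.
congr (Some (_, _, _)); last by lia.
apply: functional_extensionality => j.
rewrite /mixed_tape; case: Z.eqb_spec => [->|jp].
  rewrite Nat2Z.id pn ltnSn; case: Z.ltb_spec => //; lia.
case: Z.ltb_spec => // j0; suff -> : Z.to_nat j < p.+1 = (Z.to_nat j < p) by [].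
by rewrite ltnS leq_eqVlt; case: eqP => //; lia.
Qed.

Lemma left_sweep_reach p : p <= n ->
  reach TMstep
    (conf (left_state q (finfun x) (entries pushes p))
      (mixed_tape n.+1 p pushes final) (Z.of_nat p - 1))
    (conf (inl q) (stack_tape n.+1 final) 0).
Proof.
elim: p => [|p IH] pn.
  apply/reach1W/reach1_step => /=; congr (Some (_, _, _)).
  apply: functional_extensionality => j.
  rewrite /stack_tape /mixed_tape; case: Z.eqb_spec => [->|jp] //.
apply/reach1W; apply: reach_step (IH (ltnW pn)).
have -> : (Z.of_nat p.+1 - 1 = Z.of_nat p)%Z by lia.
rewrite /= mixed_tape_nat ltnS (ltnW pn) ltnSn /= pop_cell_entries.
congr (Some (_, _, _)).
apply: functional_extensionality => j.
rewrite /mixed_tape; case: Z.eqb_spec => [->|jp].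
  rewrite Nat2Z.id ltnS (ltnW pn) ltnn; case: Z.ltb_spec => //; lia.
case: Z.ltb_spec => // j0; suff -> : Z.to_nat j < p.+1 = (Z.to_nat j < p) by [].
by rewrite ltnS leq_eqVlt; case: eqP => //; lia.
Qed.

End OneStep.

(** The number [n] of cells in use only bounds the stack heights, because each step adds a cell
    whether or not a stack grows. *)
Definition sweep_rel (c : Q * (K -> seq S)) (t : tm_config sweep_TM) : Prop :=
  exists2 n, forall k, size (c.2 k) <= n & t = conf (inl c.1) (stack_tape n c.2) 0.

Lemma stack_tape0 n s : (forall k, size (s k) <= n) ->
  odflt no_entry (stack_tape n s 0%Z) = entries s 0.
Proof.
by move=> sn; rewrite /stack_tape /mixed_tape /=; case: n sn => [/entries_end|].
Qed.

Lemma sweep_simulation c t : sweep_rel c t ->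
  if stack_step c is Some c' then exists2 t', reach1 TMstep t t' & sweep_rel c' t'
  else halts TMstep t.
Proof.
case: c => q s [n /= sn ->].
have tops : entries s 0 = (fun k => ohead (s k)) :> (K -> option S).
  by apply: functional_extensionality => k; rewrite ffunE; case: (s k).
rewrite /stack_step /=; case dq: (delta _ _) => [[q' x]|]; last first.
  by exists 1; rewrite /orun /= stack_tape0 // tops dq.
set final := fun k => exec_cmd (x k) (s k).
exists (conf (inl q') (stack_tape n.+1 final) 0); last first.
  exists n.+1 => // k; rewrite /final /=; case: (x k) => [||y] //=.
    exact: leqW.
    by rewrite size_behead (leq_trans (leq_pred _)) // leqW.
  by rewrite ltnS.
apply: reach1_trans (left_sweep_reach q' x s (leqnn n)).
(* At cell 0, the step from [inl q] has the same effect as one from [right_state] with carry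
   [pushed], so only the first configuration of this run changes. *)
have [r hr] := right_sweep_reach q' x sn (leq0n n).
exists r; rewrite -hr /orun !iterSr /=; congr iter.
by rewrite stack_tape0 // tops dq.
Qed.

Lemma sweep_init w : sweep_rel (stack_init w) (@tm_init A sweep_TM w).
Proof.
exists (size w) => [k|] /=; first by case: eqP; rewrite ?size_map.
congr (_, _, _); apply: functional_extensionality => j.
rewrite /stack_tape /mixed_tape; case: Z.ltb_spec => // _.
case: ltnP => jw; last by rewrite nth_default ?size_map.
(* The word is nonempty here and supplies a default letter for [nth]. *)
have a : A by case: w jw.
rewrite (nth_map a) //; congr Some.
apply/ffunP => k; rewrite !ffunE.
rewrite /=; case: eqP => _; last by rewrite onth0n.
by rewrite onthE -map_comp (nth_map a).
Qed.

End StackMachines.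

Lemma tm_runE (A : finType) (M : TM A) n c : tm_run n c = orun (@tm_step A M) n c.
Proof. by elim: n => //= n ->. Qed.

Lemma tm_haltsE (A : finType) (M : TM A) w :
  tm_halts M w <-> halts (@tm_step A M) (@tm_init A M w).
Proof. by split=> -[n hn]; exists n; rewrite tm_runE in hn *. Qed.

Lemma stack_machine_re (A Q K S : finType)
    (delta : Q -> (K -> option S) -> option (Q * (K -> stack_cmd S))) k0
    (in_sym : A -> S) q0 :
  re_lang (fun w => halts (stack_step delta) (stack_init k0 in_sym q0 w)).
Proof.
exists (sweep_TM delta k0 in_sym q0) => w; rewrite tm_haltsE.
exact: halts_simulation (@sweep_simulation _ _ _ _ _ _ _ _) _ _ (sweep_init _ _ _ _ _).
Qed.

(** * Languages of tape automata are recursively enumerable *)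

Section Schedules.
Variables (A G : finType) (m : TapeAut A G).

(* [true] asks for the next letter and [false] for a silent step; a request for
   a letter when none is left is executed as a silent step. *)
Fixpoint sched_acc (s : seq bool) (w : seq A) (c : state m * Tape G) : bool :=
  if s is b :: s' then
    match b, w with
    | true, a :: u => sched_acc s' u (rel_step (Some a) c)
    | _, _ => sched_acc s' w (rel_step None c)
    end
  else nilp w && rel_out c.

(** A schedule writes the successive numbers of silent steps in unary, with [true] closing the block
    before each letter. *)
Lemma rel_acc_sched w c : rel_acc w c <-> exists s, sched_acc s w c.
Proof.
have silent n s u d : sched_acc (nseq n false ++ s) u d =
    sched_acc s u (iter n (rel_step None) d).
  by elim: n d => //= n IH d; rewrite IH -iterSr.
split.
  elim: w c => [|a u IH] c /= [n].
    by exists (nseq n false ++ [::]); rewrite silent.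
  by case/IH=> s hs; exists (nseq n false ++ true :: s); rewrite silent.
case=> s; elim: s w c => [|b s IH] w c /=; first by case: w => // out_c; exists 0.
case: w b => [|a u] [] /IH; try by case=> n hn; exists n.+1; rewrite iterSr.
by exists 0.
Qed.

End Schedules.

Fixpoint bij_incr (c : bool) (t : seq bool) : seq bool :=
  if t is b :: t' then (b (+) c) :: bij_incr (b && c) t' else if c then [:: false] else [::].

Lemma bij_incr_false t : bij_incr false t = t.
Proof. by elim: t => //= b t IH; rewrite addbF andbF IH. Qed.

(* Bijective binary numeration: [false] and [true] are the digits 1 and 2, least
   significant digit first. *)
Lemma bij_incr_surj t : exists n, t = iter n (bij_incr true) [::].
Proof.
elim: t => [|b t [n ->]]; first by exists 0.
elim: n b => [|n IH] b; first by case: b; [exists 2 | exists 1].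
(* After low digit 2 and rest [n], the next two numerals have low digits 1 and 2 and rest [n.+1]. *)
have [p hp] := IH true; case: b; [exists p.+2 | exists p.+1]; rewrite /= -hp //=.
by rewrite bij_incr_false.
Qed.

Lemma schedule_search (P : seq bool -> bool) :
  halts (fun t => if P t then None else Some (bij_incr true t)) [::] <-> exists t, P t.
Proof.
set f := fun t => _.
have run n t : orun f n t = None <-> exists2 p, p < n & P (iter p (bij_incr true) t).
  elim: n t => [|n IH] t; first by split=> // -[].
  rewrite /orun iterSr /= /f; case Pt: (P t).
    by split=> [_|_]; [exists 0 | rewrite orun_none].
  rewrite -/f [iter _ _ _ = _]IH; split=> -[p pn].
    by rewrite -iterSr; exists p.+1.
  by case: p pn => [|p] pn; rewrite ?Pt // iterSr; exists p.
split=> [[n /run [p _ hp]]|[t]]; first by exists (iter p (bij_incr true) [::]).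
by have [n ->] := bij_incr_surj t; exists n.+1; apply/run; exists n.
Qed.

(** * Tapes as a finite window between two stacks *)

Section Windows.
Variables (G : finType) (blank : G) (r : nat).

Definition window := {ffun 'I_(r.*2.+1) -> G}.

(** Window cell [n] sits at position [n - r]. The lists [l] and [q] give the cells on either side,
    nearest first, continued by blanks. *)
Definition view (l : seq G) (v : window) (q : seq G) : Tape G := fun j =>
  let n := (j + Z.of_nat r)%Z in
  if (n <? 0)%Z then nth blank l (Z.to_nat (- n - 1))
  else if Z.to_nat n < r.*2.+1 then v (inord (Z.to_nat n))
  else nth blank q (Z.to_nat n - r.*2.+1).

Definition window_of (s : Tape G) : window :=
  [ffun i : 'I_(r.*2.+1) => s (Z.of_nat i - Z.of_nat r)%Z].

Definition window_right (v : window) (o : option G) : window :=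
  [ffun i : 'I_(r.*2.+1) => if i.+1 < r.*2.+1 then v (inord i.+1) else odflt blank o].

Definition window_left (v : window) (o : option G) : window :=
  [ffun i : 'I_(r.*2.+1) => if (i : nat) is j.+1 then v (inord j) else odflt blank o].

Definition blank_window : window := [ffun=> blank].

Lemma view_blank : view [::] blank_window [::] = fun=> blank.
Proof.
apply: functional_extensionality => j; rewrite /view !nth_nil ffunE.
by case: ifP => // _; case: ifP.
Qed.

Lemma view_near l v q : near 0%Z r (view l v q) (view [::] v [::]).
Proof.
move=> j jr; rewrite /view; case: Z.ltb_spec; first by lia.
case: ltnP => //; lia.
Qed.

(** An operation of radius [r] changes window cells only, so both stacks stay valid and the window
    alone is reloaded. *)
Lemma view_update l v q s : far 0%Z r s (view l v q) -> view l (window_of s) q = s.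
Proof.
move=> sv; apply: functional_extensionality => j.
have [jr|jr] : (Z.abs (0 - j) > Z.of_nat r \/ Z.abs (0 - j) <= Z.of_nat r)%Z by lia.
  rewrite sv // /view; case: Z.ltb_spec => //.
  case: ltnP => //; lia.
rewrite /view; case: Z.ltb_spec; first by lia.
case: ltnP => [jr' _|]; last by lia.
rewrite ffunE inordK //; congr s; lia.
Qed.

Lemma view_right l (v : window) q :
  view (v ord0 :: l) (window_right v (ohead q)) (behead q) = shiftT (view l v q) 1%Z.
Proof.
apply: functional_extensionality => j; rewrite /shiftT /view.
set n := (j + Z.of_nat r)%Z; have -> : (j + 1 + Z.of_nat r = n + 1)%Z by lia.
case: Z.ltb_spec => n0; case: Z.ltb_spec => n1.
- have -> : Z.to_nat (- n - 1) = (Z.to_nat (- (n + 1) - 1)).+1 by lia.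
  by [].
(* This is the cell that has just left the window on the left. *)
- have -> : n = (-1)%Z by lia.
  by rewrite /=; congr (v _); apply/val_inj; rewrite /= inordK.
- lia.
have -> : Z.to_nat (n + 1) = (Z.to_nat n).+1 by lia.
case: ltnP => nr; last by rewrite ltnNge ltnW //= nth_behead subSn.
rewrite ffunE inordK //; case: ltnP => // nr'.
have -> : (Z.to_nat n).+1 = r.*2.+1 by lia.
by rewrite subnn; case: q.
Qed.

Lemma view_left l (v : window) q :
  view (behead l) (window_left v (ohead l)) (v ord_max :: q) = shiftT (view l v q) (-1)%Z.
Proof.
apply: functional_extensionality => j; rewrite /shiftT /view.
set n := (j + Z.of_nat r)%Z; have -> : (j + -1 + Z.of_nat r = n - 1)%Z by lia.
case: Z.ltb_spec => n0; case: Z.ltb_spec => n1.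
- have -> : Z.to_nat (- (n - 1) - 1) = (Z.to_nat (- n - 1)).+1 by lia.
  by rewrite nth_behead.
- lia.
- have -> : n = 0%Z by lia.
  by rewrite /= ffunE inordK //; case: l.
have -> : Z.to_nat n = (Z.to_nat (n - 1)).+1 by lia.
case: ltnP => nr.
  by rewrite ltnW // ffunE inordK.
case: ltnP => nr'; last by rewrite subSn.
have nE : Z.to_nat (n - 1) = r.*2 by lia.
by rewrite nE subnn /=; congr (v _); apply/val_inj; rewrite /= inordK.
Qed.

End Windows.

(** * The stack machine that tries all schedules *)

Section Search.
Variables (A G : finType) (m : TapeAut A G) (blank : G) (r : nat) (x0 : state m).

Hypothesis trans_local : forall (a : option A) (x : state m) s s', near 0%Z r s s' ->
  let p := sval (trans a x) 0%Z in
  [/\ near 0%Z r (p s).2 (p s').2, (p s).1 = (p s').1,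
      (Z.abs (p s).1.2 <= Z.of_nat r)%Z & far 0%Z r (p s).2 s].
Hypothesis out_local : forall (x : state m) s s', near 0%Z r s s' ->
  sval (out x) 0%Z s = sval (out x) 0%Z s'.

Local Notation win := (window G r).
Local Notation move := (bool * 'I_r.+1)%type.
Local Notation View := (view blank).

Definition view_win (v : win) : Tape G := View [::] v [::].

Definition shift_of (d : move) : Z :=
  if d.1 then Z.of_nat d.2 else (- Z.of_nat d.2)%Z.

(** By locality the step can be computed with blanks around the window, so it fits in a finite
    transition table. *)
Definition win_step (a : option A) (x : state m) (v : win) : state m * win * move :=
  let p := sval (trans a x) 0%Z (view_win v) in
  (p.1.1, window_of r p.2, (0 <=? p.1.2, inord (Z.abs_nat p.1.2))%Z).

Lemma rel_step_win a x l v q : let p := win_step a x v in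
  rel_step a (x, View l v q) = (p.1.1, shiftT (View l p.1.2 q) (shift_of p.2)).
Proof.
have [h1 h2 h3 h4] := trans_local a x (view_near blank l v q).
(* Sign and absolute value recover the displacement; its bound [r] makes [inord] exact. *)
rewrite /rel_step /= h2; congr (_, _); rewrite /shift_of /= inordK.
  have -> : (if (0 <=? (sval (trans a x) 0 (view_win v)).1.2)%Z
             then Z.of_nat (Z.abs_nat (sval (trans a x) 0%Z (view_win v)).1.2)
             else - Z.of_nat (Z.abs_nat (sval (trans a x) 0 (view_win v)).1.2))%Z
          = (sval (trans a x) 0%Z (view_win v)).1.2.
    by case: Z.leb_spec; lia.
  apply: (f_equal (fun s => shiftT s _)); rewrite -(view_update h4).
  apply: (f_equal (fun v => View l v q)).
  apply/ffunP => i; rewrite !ffunE; apply: (h1 (_ - _)%Z); have := ltn_ord i; lia.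
by move: h3; rewrite h2 -/(view_win v); lia.
Qed.

Lemma rel_out_win (x : state m) l v q : rel_out (x, View l v q) = sval (out x) 0%Z (view_win v).
Proof. exact/out_local/view_near. Qed.

Definition symbol := (A + G + bool)%type.
Definition letter (a : A) : symbol := inl (inl a).
Definition tape_sym (g : G) : symbol := inl (inr g).
Definition bit (b : bool) : symbol := inr b.

Definition tape_top (o : option symbol) : option G :=
  if o is Some (inl (inr g)) then Some g else None.

Definition pop_tape (o : option symbol) : stack_cmd symbol :=
  if tape_top o is Some _ then Pop else Keep.

(* A stack of tape symbols ends at the first symbol of another kind, so that
   pushing such a symbol empties it. *)
Fixpoint tape_prefix (s : seq symbol) : seq G :=
  if s is inl (inr g) :: s' then g :: tape_prefix s' else [::].

Lemma tape_topE s : tape_top (ohead s) = ohead (tape_prefix s).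
Proof. by case: s => [|[[]|] s]. Qed.

Lemma pop_tapeE s : tape_prefix (exec_cmd (pop_tape (ohead s)) s) = behead (tape_prefix s).
Proof. by case: s => [|[[]|] s]. Qed.

(* [inl (x, v, d)] simulates state [x] with the window [v] around the head, which
   still has to be moved by [d]; [inr None] restores the input and
   [inr (Some c)] restores the incremented schedule, with carry [c]. *)
Definition search_state := (state m * win * move + option bool)%type.

Definition cmds6 :=
  (stack_cmd symbol * stack_cmd symbol * stack_cmd symbol *
   stack_cmd symbol * stack_cmd symbol * stack_cmd symbol)%type.

(* The stacks: remaining input, consumed input, remaining schedule, consumed
   schedule, tape to the left and tape to the right of the window. *)
Definition search_prog (q : search_state) (i j s t l u : option symbol)
    : option (search_state * cmds6) :=
  match q with
  | inl (x, v, (d, n)) =>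
      if (n : nat) is n'.+1 then
        if d then Some (inl (x, window_right blank v (tape_top u), (d, inord n')),
                        (Keep, Keep, Keep, Keep, Push (tape_sym (v ord0)), pop_tape u))
        else Some (inl (x, window_left blank v (tape_top l), (d, inord n')),
                   (Keep, Keep, Keep, Keep, pop_tape l, Push (tape_sym (v ord_max))))
      else match s, i with
      | Some (inr true), Some (inl (inl a)) =>
          Some (inl (win_step (Some a) x v),
                (Pop, Push (letter a), Pop, Push (bit true), Keep, Keep))
      | Some (inr b), _ =>
          Some (inl (win_step None x v), (Keep, Keep, Pop, Push (bit b), Keep, Keep))
      | _, _ =>
          if ~~ isSome i && sval (out x) 0%Z (view_win v) then None
          else Some (inr None, (Keep, Keep, Keep, Keep, Keep, Keep))
      end
  | inr None =>
      if j is Some a then Some (inr None, (Push a, Pop, Keep, Keep, Keep, Keep))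
      else Some (inr (Some true), (Keep, Keep, Keep, Keep, Keep, Keep))
  | inr (Some c) =>
      if t is Some (inr b)
      then Some (inr (Some (b && c)), (Keep, Keep, Push (bit (b (+) c)), Pop, Keep, Keep))
      else Some (inl (x0, blank_window blank r, (true, ord0)),
                 (Keep, Keep, if c then Push (bit false) else Keep, Keep,
                  Push (bit true), Push (bit true)))
  end.

Definition stack_name k (lt_k6 : k < 6) : 'I_6 := Ordinal lt_k6.

Definition search_delta (q : search_state) (top : 'I_6 -> option symbol) :=
  if search_prog q (top (@stack_name 0 isT)) (top (@stack_name 1 isT))
       (top (@stack_name 2 isT)) (top (@stack_name 3 isT))
       (top (@stack_name 4 isT)) (top (@stack_name 5 isT))
  is Some (q', (a, b, c, d, e, f))
  then Some (q', fun k : 'I_6 => nth Keep [:: a; b; c; d; e; f] k) else None.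

Definition stacks (i j s t l u : seq symbol) : 'I_6 -> seq symbol :=
  fun k => nth [::] [:: i; j; s; t; l; u] k.

Local Notation step := (stack_step search_delta).
Local Notation conf q i j s t l u := ((q : search_state), stacks i j s t l u).

Lemma search_stepE q i j s t l u :
  step (conf q i j s t l u) =
  if search_prog q (ohead i) (ohead j) (ohead s) (ohead t) (ohead l) (ohead u)
    is Some (q', (a, b, c, d, e, f))
  then Some (conf q' (exec_cmd a i) (exec_cmd b j) (exec_cmd c s)
                     (exec_cmd d t) (exec_cmd e l) (exec_cmd f u))
  else None.
Proof.
rewrite /stack_step /search_delta /=; case: search_prog => // -[q' [[[[[a b] c] d] e] f]].
congr (Some (_, _)); apply: functional_extensionality.
by case=> -[|[|[|[|[|[|k]]]]]].
Qed.

Lemma move_reach x v d n i j s t l u : exists v' l' u',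
  reach step (conf (inl (x, v, (d, n))) i j s t l u)
             (conf (inl (x, v', (d, ord0))) i j s t l' u') /\
  View (tape_prefix l') v' (tape_prefix u') =
    shiftT (View (tape_prefix l) v (tape_prefix u)) (shift_of (d, n)).
Proof.
case: n => n; elim: n v l u => [|n IH] v l u lt_n.
  exists v, l, u; split.
    have -> : Ordinal lt_n = ord0 by apply/val_inj.
    exact: reach_refl.
  by rewrite /shift_of /=; case: d; rewrite shiftT0.
have inordE : inord n = Ordinal (ltnW lt_n) by apply/val_inj; rewrite /= inordK // ltnW.
case: d IH => IH.
  have [v' [l' [u' [h e]]]] := IH (window_right blank v (tape_top (ohead u)))
    (tape_sym (v ord0) :: l) (exec_cmd (pop_tape (ohead u)) u) (ltnW lt_n).
  exists v', l', u'; split.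
    by apply/reach1W; apply: reach_step h; rewrite search_stepE /= inordE.
  rewrite e pop_tapeE tape_topE /= view_right shiftTD.
  by apply: (f_equal (shiftT _)); rewrite /shift_of /=; lia.
have [v' [l' [u' [h e]]]] := IH (window_left blank v (tape_top (ohead l)))
  (exec_cmd (pop_tape (ohead l)) l) (tape_sym (v ord_max) :: u) (ltnW lt_n).
exists v', l', u'; split.
  by apply/reach1W; apply: reach_step h; rewrite search_stepE /= inordE.
rewrite e pop_tapeE tape_topE /= view_left shiftTD.
by apply: (f_equal (shiftT _)); rewrite /shift_of /=; lia.
Qed.

Lemma rel_step_reach a x v i j s t l u : exists x' d v' l' u',
  reach step (conf (inl (win_step a x v)) i j s t l u)
             (conf (inl (x', v', (d, ord0))) i j s t l' u') /\
  rel_step a (x, View (tape_prefix l) v (tape_prefix u)) =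
    (x', View (tape_prefix l') v' (tape_prefix u')).
Proof.
have := rel_step_win a x (tape_prefix l) v (tape_prefix u).
case: (win_step a x v) => [[x' v1] [d n]] ->.
have [v' [l' [u' [h e]]]] := move_reach x' v1 d n i j s t l u.
by exists x', d, v', l', u'; rewrite e.
Qed.

(** Here [w] is the whole input and [t] the whole schedule reversed. A rejecting run keeps both
    recoverable and may leave anything on the tape stacks. *)
Definition run_outcome acc t w start :=
  if acc then halts step start
  else exists w' j' l' u',
    reach1 step start (conf (inr None) (map letter w') (map letter j') [::] (map bit t) l' u') /\
    catrev j' w' = w.

Lemma run_outcome_reach acc t w start start' :
  reach1 step start start' -> run_outcome acc t w start' -> run_outcome acc t w start.
Proof.
move=> h; rewrite /run_outcome; case: acc => [|[w' [j' [l' [u' [h' e]]]]]].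
  by move/(halts_reach (reach1W h)).
by exists w', j', l', u'; split=> //; apply: reach1_trans h (reach1W h').
Qed.

Lemma run_schedule s w j t x v d l u :
  run_outcome (sched_acc s w (x, View (tape_prefix l) v (tape_prefix u)))
    (catrev s t) (catrev j w)
    (conf (inl (x, v, (d, ord0))) (map letter w) (map letter j) (map bit s) (map bit t) l u).
Proof.
elim: s w j t x v d l u => [|b s IH] w j t x v d l u.
  rewrite /run_outcome /= rel_out_win; case acc: (_ && _).
    by exists 1; rewrite /orun /= search_stepE /=; case: w acc => //= ->.
  exists w, j, l, u; split=> //; apply: reach1_step; rewrite search_stepE /=.
  by case: w acc => //= ->.
(* A step that consumes [b], silent or not, preserves the whole input [catrev j w], so the induction
   hypothesis concludes. *)
have continue a w' j' : catrev j' w' = catrev j w ->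
    step (conf (inl (x, v, (d, ord0))) (map letter w) (map letter j)
               (map bit (b :: s)) (map bit t) l u) =
      Some (conf (inl (win_step a x v)) (map letter w') (map letter j')
                 (map bit s) (map bit (b :: t)) l u) ->
    run_outcome (sched_acc s w' (rel_step a (x, View (tape_prefix l) v (tape_prefix u))))
      (catrev s (b :: t)) (catrev j w)
      (conf (inl (x, v, (d, ord0))) (map letter w) (map letter j)
            (map bit (b :: s)) (map bit t) l u).
  move=> <- st.
  have [x' [d' [v' [l' [u' [h ->]]]]]] := rel_step_reach a x v (map letter w')
    (map letter j') (map bit s) (map bit (b :: t)) l u.
  exact: run_outcome_reach (reach_step st h) (IH _ _ _ _ _ _ _ _).
case: w b continue => [|a w] [] continue.
- by apply: continue; last by rewrite search_stepE.
- by apply: continue; last by rewrite search_stepE.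
- by apply: (continue (Some a) w (a :: j)); last by rewrite search_stepE.
- by apply: (continue None (a :: w) j); last by rewrite search_stepE.
Qed.

Lemma restore_input w j t l u :
  reach step (conf (inr None) (map letter w) (map letter j) [::] t l u)
             (conf (inr (Some true)) (map letter (catrev j w)) [::] [::] t l u).
Proof.
elim: j w => [|a j IH] w; apply/reach1W; apply: reach_step; try exact: IH (a :: w).
  by rewrite search_stepE.
exact: reach_refl.
by rewrite search_stepE.
Qed.

(** The increment is done while the digits are moved back. The bits pushed on the tape stacks then
    hide the remains of the last run, which restores the blank tape. *)
Lemma restore_schedule c t i s l u :
  reach step (conf (inr (Some c)) i [::] s (map bit t) l u)
    (conf (inl (x0, blank_window blank r, (true, ord0))) i [::]
       (catrev (map bit (bij_incr c t)) s) [::] (bit true :: l) (bit true :: u)).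
Proof.
elim: t c s => [|b t IH] c s; apply/reach1W.
  by apply: reach1_step; rewrite search_stepE; case: c.
by apply: reach_step (IH _ _); rewrite search_stepE.
Qed.

(** The schedule executed is the numeral [t] reversed: consuming it puts the least significant digit
    on top, where the increment begins. *)
Definition search_rel w (t : seq bool) (c : search_state * ('I_6 -> seq symbol)) :=
  exists l u, [/\ tape_prefix l = [::], tape_prefix u = [::] &
    c = conf (inl (x0, blank_window blank r, (true, ord0))) (map letter w) [::]
             (map bit (rev t)) [::] l u].

Lemma search_halts w :
  halts step (stack_init (K := 'I_6) ord0 letter
                (inl (x0, blank_window blank r, (true, ord0))) w) <->
  rel_acc w (x0, fun=> blank).
Proof.
pose P t := sched_acc (rev t) w (x0, fun=> blank : G).
have sim t c : search_rel w t c ->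
    if (if P t then None else Some (bij_incr true t)) is Some t'
    then exists2 c', reach1 step c c' & search_rel w t' c' else halts step c.
  case=> l [u [l0 u0 ->]].
  have := run_schedule (rev t) w [::] [::] x0 (blank_window blank r) true l u.
  rewrite /run_outcome /P l0 u0 view_blank; case: sched_acc => //.
  case=> [w' [j' [l' [u' [h e]]]]].
  exists (conf (inl (x0, blank_window blank r, (true, ord0))) (map letter w) [::]
             (map bit (rev (bij_incr true t))) [::] (bit true :: l') (bit true :: u')).
    apply: reach1_trans h _; apply: reach_trans (restore_input _ _ _ _ _) _.
    rewrite e /= -/(rev _) revK map_rev; exact: restore_schedule.
  by exists (bit true :: l'), (bit true :: u').
rewrite rel_acc_sched -(halts_simulation sim (u := [::])); last first.
  exists [::], [::]; split=> //; congr (_, _).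
  by apply: functional_extensionality; case=> -[|[|[|[|[|[|k]]]]]].
rewrite (schedule_search P); split=> -[s]; first by exists (rev s).
by exists (rev s); rewrite /P revK.
Qed.

End Search.

(** * A common radius for all transitions and outputs *)

Section UniformRadius.
Variables (A G : finType) (m : TapeAut A G).

Lemma near_mono i k k' (s s' : Tape G) : k <= k' -> near i k' s s' -> near i k s s'.
Proof. by move=> kk' h j hj; apply: h; lia. Qed.

Lemma uniform_radius : exists r,
  (forall (a : option A) (x : state m) s s', near 0%Z r s s' ->
    let p := sval (trans a x) 0%Z in
    [/\ near 0%Z r (p s).2 (p s').2, (p s).1 = (p s').1,
        (Z.abs (p s).1.2 <= Z.of_nat r)%Z & far 0%Z r (p s).2 s]) /\
  (forall (x : state m) s s', near 0%Z r s s' ->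
    sval (out x) 0%Z s = sval (out x) 0%Z s').
Proof.
have [f hf] := fin_all_exists (fun c : option A * state m => svalP (trans c.1 c.2)).
have [g hg] := fin_all_exists (fun x : state m => svalP (out x)).
pose r := maxn (\max_c f c) (\max_x g x).
have fr c : f c <= r by exact: leq_trans (leq_bigmax _) (leq_maxl _ _).
have gr x : g x <= r by exact: leq_trans (leq_bigmax _) (leq_maxr _ _).
exists r; move: r fr gr => r fr gr; split=> [a x|x] s s' ss'; last first.
  by have [] := hg x 0%Z 0%Z s s' (near_mono (gr x) ss').
have fx := fr (a, x).
have ss := near_mono fx ss'; have s's : near 0%Z (f (a, x)) s' s.
  by move=> j /ss ->.
have [h1 [h2 [h3 [h4 [h5 _]]]]] := hf (a, x) 0%Z 0%Z s s' ss.
have [_ [_ [_ [h4' _]]]] := hf (a, x) 0%Z 0%Z s' s s's.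
rewrite /=; split.
(* Between the radius of this transition and [r] neither tape is changed, so the results agree
   because [s] and [s'] do. *)
- move=> j hj; case: (Z.leb_spec (Z.abs (0 - j)) (Z.of_nat (f (a, x)))) => [/h1//|hj'].
  by rewrite h4 ?h4'; [apply: ss' | lia | lia].
- by move: h2 h5; do 2!case: (sval _ _ _) => -[? ?] ?; move=> /= -> ->.
- by move: h3 => /=; lia.
by move=> j hj; apply: h4; lia.
Qed.

End UniformRadius.

Lemma tau_lang_re (A G : finType) (blank : G) (m : TapeAut A G) (x : state m) :
  re_lang (tau_lang blank m x).
Proof.
have [r [trans_local out_local]] := uniform_radius m.
have [M hM] := stack_machine_re (search_delta blank (r := r) x)
  (ord0 : 'I_6) (@letter A G) (inl (x, blank_window blank r, (true, ord0))).
by exists M => w; rewrite -hM tau_langP (search_halts blank x trans_local out_local).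
Qed.

(** * Simulation of Turing machines by tape automata *)

Section LocalOperations.
Variables (G X : Type) (r : nat) (f : Tape G -> X * Z * Tape G).
Hypothesis f_local : forall s s', near 0%Z r s s' ->
  [/\ near 0%Z r (f s).2 (f s').2, (f s).1 = (f s').1,
      (Z.abs (f s).1.2 <= Z.of_nat r)%Z & far 0%Z r (f s).2 s].

(** The shift laws force this extension of an operation given at the origin. *)
Definition local_op (i : Z) (s : Tape G) : X * Z * Tape G :=
  let p := f (shiftT s i) in (p.1.1, (i + p.1.2)%Z, shiftT p.2 (- i)%Z).

Lemma local_op_is_tape_op : is_tape_op local_op.
Proof.
exists r => i j s s' ss'; rewrite /local_op /=.
have [|h1 h2 h3 h4] := f_local (s := shiftT s i) (s' := shiftT s' i).
  by move=> l hl; apply: ss'; lia.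
split; first by move=> l hl; apply: h1; lia.
split; first by rewrite h2.
split; first by lia.
split.
  move=> l hl; rewrite /shiftT h4 /shiftT; last by lia.
  by congr s; lia.
split; first by rewrite h2.
rewrite shiftTD; split; last by split=> //; lia.
by move=> l; rewrite /shiftT; congr (_.2 _); lia.
Qed.

Definition local_TX : TX G X := exist _ local_op local_op_is_tape_op.

End LocalOperations.

Variant stage := Loading | Rewinding | Halted | Dead.

Definition stage_code (x : stage) : bool * bool :=
  match x with
  | Loading => (true, true) | Rewinding => (true, false)
  | Halted => (false, true) | Dead => (false, false)
  end.
Definition stage_decode (x : bool * bool) : stage :=
  match x with
  | (true, true) => Loading | (true, false) => Rewinding
  | (false, true) => Halted | (false, false) => Dead
  end.
Lemma stage_codeK : cancel stage_code stage_decode.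
Proof. by case. Qed.

HB.instance Definition _ := Countable.copy stage (can_type stage_codeK).
HB.instance Definition _ := Finite.copy stage (can_type stage_codeK).

(** * The automaton that loads the input and runs the Turing machine *)

Section TMAutomaton.
Variables (A G : finType) (M : TM A) (blank mark : G).

Local Notation S := (tmS M).

(* A tape symbol occupies a block of [#|S| + 1] cells: the first one is marked
   when the block has been written, and the symbol [a] is coded by a mark at
   offset [enum_rank a + 1]. *)
Definition width := #|S|.+1.

Definition pos (b : Z) : Z := (b * Z.of_nat width)%Z.
Arguments pos : simpl never.

Lemma pos1 : pos 1 = Z.of_nat width.
Proof. by rewrite /pos; lia. Qed.

Lemma posN1 : pos (-1) = (- Z.of_nat width)%Z.
Proof. by rewrite /pos; lia. Qed.

Definition sym_pos (a : S) : Z := (Z.of_nat (enum_rank a) + 1)%Z.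

(** An unwritten block reads as the blank of [M], so the blank tape already codes the empty one. *)
Definition read_block (s : Tape G) : S :=
  odflt (tm_blank M) [pick a | s (sym_pos a) != blank].
Arguments read_block : simpl never.

Definition write_block (a : S) (s : Tape G) : Tape G := fun j =>
  if ((0 <=? j) && (j <? Z.of_nat width))%Z then
    if (j =? 0)%Z || (j =? sym_pos a)%Z then mark else blank
  else s j.

Definition aut_state := (tmQ M + stage)%type.

(** Rewinding stops at block -1, the first unmarked one to the left of the input. With empty input
    the first silent step goes there directly. *)
Definition tm_op (a : option A) (x : aut_state) (s : Tape G) : aut_state * Z * Tape G :=
  match a, x with
  | Some a, inr Loading => (inr Loading, Z.of_nat width, write_block (tm_in M a) s)
  | None, inr Loading => (inr Rewinding, (- Z.of_nat width)%Z, s)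
  | None, inr Rewinding =>
      if s 0%Z != blank then (inr Rewinding, (- Z.of_nat width)%Z, s)
      else (inl (tm_start M), Z.of_nat width, s)
  | None, inl q =>
      if tm_delta q (read_block s) is Some (q', c, d)
      then (inl q', if d then Z.of_nat width else (- Z.of_nat width)%Z, write_block c s)
      else (inr Halted, 0%Z, s)
  | None, inr Halted => (inr Halted, 0%Z, s)
  | _, _ => (inr Dead, 0%Z, s)
  end.

Lemma sym_pos_bounds a : (0 < sym_pos a < Z.of_nat width)%Z.
Proof. by rewrite /sym_pos /width; have : enum_rank a < #|S| := ltn_ord _; lia. Qed.

Lemma read_block_near s s' : near 0%Z width s s' -> read_block s = read_block s'.
Proof.
move=> ss'; rewrite /read_block; congr odflt; apply: eq_pick => a /=.
by rewrite ss' //; have := sym_pos_bounds a; lia.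
Qed.

Lemma write_block_near a s s' :
  near 0%Z width s s' -> near 0%Z width (write_block a s) (write_block a s').
Proof. by move=> ss' j hj; rewrite /write_block; case: ifP => // _; exact: ss'. Qed.

Lemma write_block_far a s : far 0%Z width (write_block a s) s.
Proof. by move=> j hj; rewrite /write_block; case: ifP => //; lia. Qed.

Lemma tm_op_local a x s s' : near 0%Z width s s' ->
  [/\ near 0%Z width (tm_op a x s).2 (tm_op a x s').2, (tm_op a x s).1 = (tm_op a x s').1,
      (Z.abs (tm_op a x s).1.2 <= Z.of_nat width)%Z & far 0%Z width (tm_op a x s).2 s].
Proof.
move=> ss'; have s0 : s 0%Z = s' 0%Z by apply: ss'; lia.
have wl a' := write_block_near a' ss'; have wf a' := write_block_far a' s.
case: a => [a|]; case: x => [q|[]] /=; rewrite -?s0 -?(read_block_near ss').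
all: try by split=> //=; lia.
- by case: tm_delta => [[[q' c] []]|]; split=> //=; lia.
- by case: ifP; split=> //=; lia.
Qed.

Lemma is_obs_state (p : bool) : @is_obs G (fun _ _ => p).
Proof. by exists 0. Qed.

Definition TM_aut : TapeAut A G :=
  {| state := aut_state;
     out := fun x => exist _ _ (is_obs_state (x == inr Halted));
     trans := fun a x => local_TX (tm_op_local a x) |}.

Local Notation st := (@rel_step A G TM_aut).

Lemma rel_step_TM a x s :
  st a (x, s) = ((tm_op a x s).1.1, shiftT (tm_op a x s).2 (tm_op a x s).1.2).
Proof. by rewrite /rel_step /= /local_op shiftT0 /= shiftT0. Qed.

(* A silent step taken before the end of the input spoils the run. *)
Lemma rel_acc_not_loading a w c :
  c.1 <> inr Loading -> ~ rel_acc (m := TM_aut) (a :: w) c.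
Proof.
have silent n : forall c : aut_state * Tape G, c.1 <> inr Loading ->
    (iter n (st None) c).1 <> inr Loading.
  elim: n => // n IH d hd; rewrite iterSr; apply: IH.
  case: d hd => [[q|[]] s]; rewrite rel_step_TM //=.
    by case: tm_delta => // [[[]]].
  by case: ifP.
have dead n s : iter n (st None) (inr Dead, s) = (inr Dead, s).
  by elim: n => //= n ->; rewrite rel_step_TM /= shiftT0.
have letter_dead b d : d.1 <> inr Loading -> exists s, st (Some b) d = (inr Dead, s).
  case: d => [[q|[]] s] hd;
  first [by case: hd | by eexists; rewrite rel_step_TM].
elim: w a c => [|b w IH] a c hc [n]; have [s] := letter_dead a _ (silent n c hc).
  by move=> -> [p]; rewrite dead.
by move=> hs; apply: (IH b); rewrite hs.
Qed.

(** The number of silent steps before a letter must be 0, since any such step leaves [Loading] for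
    good. *)
Lemma rel_acc_loading a w s :
  rel_acc (m := TM_aut) (a :: w) (inr Loading, s) <->
  rel_acc (m := TM_aut) w (st (Some a) (inr Loading, s)).
Proof.
split; last by exists 0.
case=> -[//|n]; rewrite iterSr => h; exfalso.
apply: (@rel_acc_not_loading a w (st None (inr Loading, s))); last by exists n.
by rewrite rel_step_TM.
Qed.

(** Acceptance becomes halting, so that [halts_simulation] applies. *)
Definition final_step (c : aut_state * Tape G) : option (aut_state * Tape G) :=
  if c.1 == inr Halted then None else Some (st None c).

Lemma rel_acc_halts c : rel_acc (m := TM_aut) [::] c <-> halts final_step c.
Proof.
split=> -[n hn].
  elim: n c hn => [|n IH] c.
    by move=> hc; exists 1; rewrite /orun /= /final_step [_ == _]hc.
  rewrite iterSr => /IH [p hp]; case hc: (c.1 == inr Halted).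
    by exists 1; rewrite /orun /= /final_step hc.
  by exists p.+1; rewrite (@orunS _ _ _ _ (st None c)) // /final_step hc.
elim: n c hn => // n IH c; case hc: (c.1 == inr Halted); first by exists 0.
rewrite (@orunS _ _ _ _ (st None c)); last by rewrite /final_step hc.
by move/IH=> [p hp]; exists p.+1; rewrite iterSr.
Qed.

(* [s] is a tape relative to the head, which is at block [h] of the tape [t]. *)
Definition encodes (s : Tape G) (t : Tape S) (h : Z) :=
  forall b, read_block (shiftT s (pos b)) = t (h + b)%Z.

Definition marks (s : Tape G) (n h : Z) :=
  forall b, (s (pos b) != blank) = ((0 <=? h + b) && (h + b <? n))%Z.

Lemma encodes_shift s t h d : encodes s t h -> encodes (shiftT s (pos d)) t (h + d)%Z.
Proof.
move=> e b; rewrite shiftTD -/(pos _) /pos -Z.mul_add_distr_r -/(pos _) e.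
by congr t; lia.
Qed.

Lemma marks_shift s n h d : marks s n h -> marks (shiftT s (pos d)) n (h + d)%Z.
Proof.
move=> e b; rewrite /shiftT /pos -Z.mul_add_distr_r -/(pos _) e.
by congr (_ && _); lia.
Qed.

Hypothesis mark_blank : mark != blank.

Lemma read_write a s : read_block (write_block a s) = a.
Proof.
have wE c : write_block a s (sym_pos c) = if c == a then mark else blank.
  have bounds := sym_pos_bounds c; rewrite /write_block.
  have -> : ((0 <=? sym_pos c) && (sym_pos c <? Z.of_nat width))%Z by lia.
  case: Z.eqb_spec => [|_ /=]; first by lia.
  case: Z.eqb_spec => [e|ne]; case: eqP => // ca; last by rewrite ca in ne.
  by case: ca; apply/enum_rank_inj/val_inj; move: e; rewrite /sym_pos /=; lia.
rewrite /read_block; case: pickP => [c|/(_ a)] /=; rewrite wE.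
  by case: (c =P a) => // _; rewrite eqxx.
by rewrite eqxx mark_blank.
Qed.

(** Blocks are disjoint, so writing block 0 leaves all the others intact. *)
Lemma pos_far b j : (b <> 0)%Z -> (0 <= j < Z.of_nat width)%Z ->
  ((0 <=? j + pos b) && (j + pos b <? Z.of_nat width))%Z = false.
Proof. by rewrite /pos; nia. Qed.

Lemma encodes_write a s t h : encodes s t h ->
  encodes (write_block a s) (fun j => if (j =? h)%Z then a else t j) h.
Proof.
move=> e b; case: (Z.eq_dec b 0) => [->|b0].
  by rewrite shiftT0 read_write Z.add_0_r Z.eqb_refl.
case: Z.eqb_spec => [|_]; first by lia.
rewrite -e /read_block; congr odflt; apply: eq_pick => c.
rewrite /shiftT /write_block pos_far //; have := sym_pos_bounds c; lia.
Qed.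

Lemma marks_write a s n : (0 <= n)%Z -> marks s n n -> marks (write_block a s) (n + 1) n.
Proof.
move=> n0 e b; case: (Z.eq_dec b 0) => [->|b0].
  by rewrite /write_block /= mark_blank; lia.
by rewrite /write_block (pos_far (j := 0)) // e; lia.
Qed.

Definition input_tape (w : seq A) : Tape S := fun j =>
  if (j <? 0)%Z then tm_blank M else nth (tm_blank M) (map (@tm_in A M) w) (Z.to_nat j).

Lemma input_tape_rcons w a :
  input_tape (rcons w a) =
  fun j => if (j =? Z.of_nat (size w))%Z then tm_in M a else input_tape w j.
Proof.
apply: functional_extensionality => j; rewrite /input_tape map_rcons nth_rcons size_map.
case: Z.ltb_spec => j0; case: Z.eqb_spec => //; first by lia.
  by move=> ->; rewrite Nat2Z.id ltnn eqxx.
by move=> jw; case: ltngtP => // [jw'|]; [rewrite nth_default // size_map ltnW | lia].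
Qed.

(** During loading, the number of marked blocks and the block of the head both equal the number of
    letters read, here those of [u]. *)
Lemma rel_acc_load u w s :
  encodes s (input_tape u) (Z.of_nat (size u)) ->
  marks s (Z.of_nat (size u)) (Z.of_nat (size u)) ->
  exists s', [/\ rel_acc (m := TM_aut) w (inr Loading, s) <->
                 rel_acc (m := TM_aut) [::] (inr Loading, s'),
    encodes s' (input_tape (u ++ w)) (Z.of_nat (size (u ++ w))) &
    marks s' (Z.of_nat (size (u ++ w))) (Z.of_nat (size (u ++ w)))].
Proof.
elim: w u s => [|a w IH] u s e f; first by exists s; rewrite cats0.
have sizeE : Z.of_nat (size (rcons u a)) = (Z.of_nat (size u) + 1)%Z by rewrite size_rcons; lia.
have [||s' [h e' f']] := IH (rcons u a) (shiftT (write_block (tm_in M a) s) (pos 1)).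
- by rewrite sizeE input_tape_rcons; apply/encodes_shift/encodes_write.
- by rewrite sizeE; apply/marks_shift/marks_write => //; lia.
exists s'; rewrite -cat_rcons; split=> //.
by rewrite rel_acc_loading rel_step_TM -h pos1.
Qed.

Definition tm_rel (c : tm_config M) (d : aut_state * Tape G) :=
  d.1 = inl c.1.1 /\ encodes d.2 c.1.2 c.2.

Lemma rewind_reach t n h s : (- 1 <= h < n)%Z -> encodes s t h -> marks s n h ->
  exists2 d, reach final_step (inr Rewinding, s) d & tm_rel (tm_start M, t, 0%Z) d.
Proof.
(* Induction on [h + 1], the number of marked blocks still to cross. *)
move=> hn; have [k hk] : exists k, h = (Z.of_nat k - 1)%Z by exists (Z.to_nat (h + 1)); lia.
elim: k h s hk hn => [|k IH] h s hk hn e f.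
  exists (inl (tm_start M), shiftT s (pos 1)).
    apply/reach1W/reach1_step; rewrite /final_step rel_step_TM /=.
    have -> : (s 0%Z != blank) = _ := f 0%Z.
    by case: ifP; [lia | rewrite pos1].
  split=> //=; have := encodes_shift 1 e; congr encodes; lia.
have [||||d hd dr] := IH (h + -1)%Z (shiftT s (pos (-1))); try by lia.
- exact: encodes_shift.
- exact: marks_shift.
exists d => //; apply/reach1W; apply: reach_step hd.
rewrite /final_step rel_step_TM /=.
have -> : (s 0%Z != blank) = _ := f 0%Z.
by case: ifP; [rewrite posN1 | lia].
Qed.

Lemma tm_simulation c d : tm_rel c d ->
  if tm_step c is Some c' then exists2 d', reach1 final_step d d' & tm_rel c' d'
  else halts final_step d.
Proof.
case: c => [[q t] h]; case: d => x s [/= -> e].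
have rd : read_block s = t h by rewrite -[s]shiftT0 (e 0%Z) Z.add_0_r.
case dq: (tm_delta q (t h)) => [[[q' a] b]|]; last first.
  (* One step enters [Halted], and there [final_step] is undefined. *)
  exists 2; rewrite (@orunS _ _ _ _ (inr Halted, s)) //.
  by rewrite /final_step rel_step_TM /= rd dq /= shiftT0.
exists (inl q', shiftT (write_block a s) (pos (if b then 1 else -1)%Z)).
  apply: reach1_step; rewrite /final_step rel_step_TM /= rd dq /=.
  by case: b {dq}; rewrite ?posN1 ?pos1.
split=> //=; have := encodes_shift (if b then 1 else -1)%Z (encodes_write a e).
by case: b {dq}.
Qed.

Lemma TM_aut_lang w :
  tau_lang blank TM_aut (inr Loading) w <-> tm_halts M w.
Proof.
rewrite tau_langP tm_haltsE.
have [||s [-> e f]] := @rel_acc_load [::] w (fun=> blank).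
- move=> b; rewrite /read_block; case: pickP => [c|_] /=; first by rewrite /shiftT eqxx.
  by rewrite /input_tape nth_nil; case: ifP.
- by move=> b /=; rewrite eqxx; lia.
rewrite rel_acc_halts; set n := Z.of_nat (size w) in e f.
(* The first silent step moves from block [n] to block [n - 1], where rewinding begins. *)
have [|||d hd dr] := @rewind_reach (input_tape w) n (n + -1)%Z (shiftT s (pos (-1))).
- by lia.
- exact: encodes_shift.
- exact: marks_shift.
rewrite (halts_simulation tm_simulation dr) -(halts_reach hd).
apply/halts_reach/reach1W.
by apply: reach1_step; rewrite /final_step rel_step_TM /= posN1.
Qed.

End TMAutomaton.

Lemma re_lang_tau (A G : finType) (blank : G) (L : seq A -> Prop) :
  2 <= #|G| -> re_lang L ->
  exists (m : TapeAut A G) (x : state m), forall w, L w <-> tau_lang blank m x w.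
Proof.
move=> card_G [M hM].
have [mark mark_blank] : exists mark : G, mark != blank.
  have /card_gt0P[g] : 0 < #|predC1 blank| by have := cardC1 blank; lia.
  by exists g.
by exists (TM_aut M blank mark), (inr Loading) => w; rewrite hM TM_aut_lang.
Qed.

Theorem mainTheorem11 (A G : finType) (blank : G) (hG : 2 <= #|G|) :
  (forall (m : TapeAut A G) (x : state m), re_lang (tau_lang blank m x)) /\
  (forall L : seq A -> Prop, re_lang L ->
     exists (m : TapeAut A G) (x : state m), forall w, L w <-> tau_lang blank m x w).
Proof. by split=> [m x|L]; [exact: tau_lang_re | exact: re_lang_tau]. Qed.
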